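(* Let $\alpha\in[0,1)$ and let $G$ be a connected graph with $n$ vertices and $m$ edges. Then $$E(A_\alpha(G))\le n\sqrt{\frac{2m(1-\alpha)^2}{n}+\frac{\alpha^2}{4}(\Delta-\delta)^2},$$ where equality holds if and only if $G\cong K_2$.
   Context: Graphs are finite and simple; $\delta$ and $\Delta$ are the minimum and maximum vertex degrees of $G$. For a graph $G$ with $n$ vertices and $m$ edges, adjacency matrix $A(G)$ and diagonal degree matrix $D(G)$, $A_\alpha(G)=\alpha D(G)+(1-\alpha)A(G)$ with eigenvalues $p_1,\dots,p_n$. The $A_\alpha$-energy is $E(A_\alpha(G))=\sum_{i=1}^n\left|p_i-\frac{2\alpha m}{n}\right|$.
   Formalization: The equality characterization is stated only for n ≥ 2: for G = K_1 (connected, n = 1, m = 0) both sides are 0, so equality holds although K_1 is not isomorphic to K_2; the inequality is kept for every connected graph. *)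

(* Defs.v *)
From HB Require Import structures.
From mathcomp Require Import all_boot all_order all_algebra.
From mathcomp Require Import polyrcf.

Set Implicit Arguments.
Unset Strict Implicit.
Unset Printing Implicit Defensive.

Import Order.TTheory GRing.Theory Num.Theory.

Local Open Scope ring_scope.

Record sgraph := SGraph {
  vertex :> finType;
  adj : rel vertex;
  adj_sym : symmetric adj;
  adj_irrefl : irreflexive adj
}.

Lemma neq_sym (T : eqType) : symmetric (fun x y : T => x != y).
Proof. by move=> x y; rewrite eq_sym. Qed.

Lemma neq_irrefl (T : eqType) : irreflexive (fun x y : T => x != y).
Proof. by move=> x; rewrite eqxx. Qed.

Definition complete_graph (n : nat) : sgraph :=
  SGraph (@neq_sym 'I_n) (@neq_irrefl 'I_n).

Definition isomorphic (G H : sgraph) : Prop :=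
  exists2 f : G -> H, bijective f & forall x y : G, adj (f x) (f y) = adj x y.

(* The graph without vertices is not connected. *)
Definition connected (G : sgraph) : Prop :=
  (0 < #|G|)%N /\ forall x y : G, connect (@adj G) x y.

Definition edges (G : sgraph) : {set {set G}} :=
  [set [set x; y] | x in G, y in G & adj x y].

Definition degree (G : sgraph) (x : G) : nat := #|[set y | adj x y]|.

Definition maxdeg (G : sgraph) : nat := (\max_(x : G) degree x)%N.

(* Every degree is less than #|G|, so the default value #|G| only matters for
   the graph without vertices. *)
Definition mindeg (G : sgraph) : nat := \big[minn/#|G|]_(x : G) degree x.

Section Matrices.

Variable R : rcfType.

Definition adjmx (G : sgraph) : 'M[R]_#|G| :=
  \matrix_(i, j) (adj (enum_val i : G) (enum_val j : G))%:R.

Definition degmx (G : sgraph) : 'M[R]_#|G| :=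
  diag_mx (\row_i (degree (enum_val i : G))%:R).

Definition Aalpha (alpha : R) (G : sgraph) : 'M[R]_#|G| :=
  alpha *: degmx G + (1 - alpha) *: adjmx G.

(* The eigenvalues of M lying in R, repeated according to their algebraic
   multiplicity; for a symmetric M these are all its eigenvalues. *)
Definition spectrum (n : nat) (M : 'M[R]_n) : seq R :=
  flatten [seq nseq (mup x (char_poly M)) x | x <- rootsR (char_poly M)].

Definition Aalpha_energy (alpha : R) (G : sgraph) : R :=
  \sum_(p <- spectrum (Aalpha alpha G))
     `|p - 2 * alpha * #|edges G|%:R / #|G|%:R|.

End Matrices.

(* Main.v *)
(* Let B = A_alpha - (2 alpha m / n) I and let t be the square root on the
   right-hand side.  The trace of B^2 is
   2 m (1 - alpha)^2 + alpha^2 sum_x (d_x - 2 m / n)^2, which Popoviciu's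
   inequality bounds by n t^2; since the energy is the sum of the |q_i| over the
   eigenvalues q_i of B, Cauchy-Schwarz gives energy <= n t, with equality iff
   B^2 = t^2 I.  In that case the off-diagonal entries of B^2 vanish, so
   non-adjacent vertices have no common neighbour; a connected graph with this
   property is complete, hence regular, and then adjacent vertices have no
   common neighbour either, which leaves only K_2. *)

Require Import Defs.
From mathcomp Require Import all_boot all_order all_algebra.
From mathcomp Require Import polyrcf complex spectral ring lra.

Set Implicit Arguments.
Unset Strict Implicit.
Unset Printing Implicit Defensive.

Import Order.TTheory GRing.Theory Num.Theory.

Local Open Scope ring_scope.

(** * Spectra of symmetric matrices over a real closed field *)

(** Each [x] occurs equally often in [spectrum M] and among the [r 0 i], namely as often as its
    multiplicity as a root, so the two lists are permutations of each other. *)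
Lemma big_spectrum (R : rcfType) n (M : 'M[R]_n) (r : 'rV[R]_n) (F : R -> R) :
  char_poly M = \prod_i ('X - (r 0 i)%:P) ->
  \sum_(p <- spectrum M) F p = \sum_i F (r 0 i).
Proof.
move=> Mr; have nz : char_poly M != 0 := monic_neq0 (char_poly_monic M).
have -> : \sum_i F (r 0 i) = \sum_(p <- [seq r 0 i | i <- enum 'I_n]) F p.
  by rewrite big_map big_enum.
apply: perm_big; apply/allP => x _ /=; apply/eqP.
rewrite -[RHS]mu_prod_XsubC big_map big_enum /= -Mr /spectrum.
rewrite count_flatten -!map_comp.
rewrite (eq_map (g := fun y => (y == x) * mup y (char_poly M))%N); last first.
  by move=> y /=; rewrite count_nseq /=.
rewrite sumnE big_map.
have [xr|xr] := boolP (x \in rootsR (char_poly M)).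
  rewrite (bigD1_seq x) //=; last exact: uniq_roots.
  by rewrite eqxx mul1n big1 ?addn0 // => y /negPf ->.
rewrite big_seq big1 => [|y yr]; last first.
  by case: eqVneq => // yx; rewrite -yx yr in xr.
(* [rootsR] lists every root in [R], so an [x] outside it has multiplicity 0. *)
rewrite mupNroot //; apply: contra xr => xr.
by rewrite -roots_on_rootsR // in_itv /=.
Qed.

(** The spectral theorem over [R[i]] gives a diagonal form, real because [M] is Hermitian. Real
    matrices similar over [R[i]] are similar through a real matrix, and taking real parts descends
    to [R]. *)
Lemma sym_similar_diag (R : rcfType) n (M : 'M[R]_n) : M^T = M ->
  exists r : 'rV[R]_n, exists2 P, P \in unitmx & P *m M = diag_mx r *m P.
Proof.
move=> Msym.
pose f := real_complex R.
pose MC := map_mx f M.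
have MCreal : MC \is a realmx.
  by apply/mxOverP => i j; rewrite mxE; apply/complex_realP; exists (M i j).
have MCsym : MC \is symmetricmx.
  by apply/is_hermitianmxP; rewrite expr0 scale1r map_mx_id // map_trmx Msym.
have MCherm := realsym_hermsym MCsym MCreal.
have Dreal := hermitian_spectral_diag_real MCherm.
have /orthomx_spectralP eqM := hermitian_normalmx MCherm.
have {}eqM : exists2 P, P \in unitmx &
    similar P MC (diag_mx (spectral_diag MC)).
  exists (spectralmx MC); rewrite ?spectral_unit //.
  apply/similarP; rewrite ?spectral_unit // {2}eqM.
  by rewrite !mulmxA mulmxV ?spectral_unit // mul1mx.
have [|P /= /andP[Preal Punit] /(similarP Punit) simP] :=
  real_similar eqM MCreal.
  apply/mxOverP => i j; rewrite mxE.
  by case: eqP => // _; rewrite ?rpred0 // mulr1n (mxOverP Dreal).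
have Re_real m' n' (A : 'M[R[i]]_(m', n')) : A \is a realmx ->
    A = map_mx f (map_mx (@complex.Re R) A).
  move=> /mxOverP Areal; apply/matrixP => i j; rewrite !mxE.
  by rewrite /f /= RRe_real.
exists (map_mx (@complex.Re R) (spectral_diag MC)), (map_mx (@complex.Re R) P).
  by rewrite -(map_unitmx f) -Re_real.
apply: (map_mx_inj (f := f)).
by rewrite !map_mxM map_diag_mx -!Re_real.
Qed.

Lemma char_poly_similar (F : fieldType) n (P A B : 'M[F]_n) :
  P \in unitmx -> P *m A = B *m P -> char_poly A = char_poly B.
Proof.
move=> Punit eqP; rewrite /char_poly.
have detP : \det (map_mx polyC P) != 0.
  by rewrite det_map_mx polyC_eq0 -unitfE -unitmxE.
apply: (mulfI detP); rewrite -det_mulmx [RHS]mulrC -det_mulmx; congr (\det _).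
rewrite /char_poly_mx mulmxBr mulmxBl -!map_mxM eqP.
by rewrite mul_mx_scalar mul_scalar_mx.
Qed.

(** A single [r] serves all three claims: the [P] that diagonalises [M] also conjugates the square
    of [M - c%:M] to the diagonal matrix of the [(r 0 i - c) ^+ 2]. *)
Lemma sym_spectrum (R : rcfType) n (M : 'M[R]_n) : M^T = M ->
  exists r : 'rV[R]_n,
  [/\ forall F : R -> R, \sum_(p <- spectrum M) F p = \sum_i F (r 0 i),
      forall c, \tr ((M - c%:M) *m (M - c%:M)) = \sum_i (r 0 i - c) ^+ 2
    & forall c s, (M - c%:M) *m (M - c%:M) = s%:M <->
                  forall i, (r 0 i - c) ^+ 2 = s].
Proof.
move=> /sym_similar_diag[r [P Punit simP]]; exists r.
have sqM c : P *m ((M - c%:M) *m (M - c%:M)) =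
    diag_mx (\row_i (r 0 i - c) ^+ 2) *m P.
  have shift : P *m (M - c%:M) = diag_mx (\row_i (r 0 i - c)) *m P.
    rewrite mulmxBr simP scalar_mxC -mulmxBl; congr (_ *m _).
    by apply/matrixP => i j; rewrite !mxE -mulrnBl.
  rewrite mulmxA shift -mulmxA shift mulmxA; congr (_ *m _).
  apply/matrixP => i j; rewrite mul_diag_mx !mxE.
  by case: eqP => [->|]; rewrite ?mulr0 // expr2.
split=> [F|c|c s].
- apply: big_spectrum; rewrite (char_poly_similar Punit simP).
  rewrite char_poly_trig ?diag_mx_is_trig //.
  by apply: eq_bigr => i _; rewrite mxE eqxx.
- rewrite -[X in \tr X]mul1mx -(mulVmx Punit) -mulmxA sqM.
  rewrite mxtrace_mulC mulmxK //.
  by rewrite mxtrace_diag; apply: eq_bigr => i _; rewrite mxE.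
- split=> [eqs i|eqs].
  have: diag_mx (\row_i (r 0 i - c) ^+ 2) *m P = s%:M *m P.
    by rewrite -sqM eqs scalar_mxC.
  move/(congr1 (mulmx^~ (invmx P))); rewrite !mulmxK // => /matrixP/(_ i i).
  by rewrite !mxE eqxx !mulr1n.
  rewrite -[LHS]mul1mx -(mulVmx Punit) -mulmxA sqM.
  have -> : diag_mx (\row_i (r 0 i - c) ^+ 2) = s%:M.
    by apply/matrixP => i j; rewrite !mxE eqs.
  by rewrite -scalar_mxC mulmxA mulVmx // mul1mx.
Qed.

Lemma sum_norm_deviation (R : rcfType) n (M : 'M[R]_n) (c t : R) :
  M^T = M -> 0 <= t ->
  \tr ((M - c%:M) *m (M - c%:M)) <= n%:R * t ^+ 2 ->
  \sum_(p <- spectrum M) `|p - c| <= n%:R * t /\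
  (\sum_(p <- spectrum M) `|p - c| = n%:R * t <->
   (M - c%:M) *m (M - c%:M) = (t ^+ 2)%:M).
Proof.
move=> /sym_spectrum[r [-> -> ->]] t_ge0 le_t.
set E := \sum_i _.
have const_t : (forall i, `|r 0 i - c| = t) -> E = n%:R * t.
  move=> eqt; rewrite /E (eq_bigr _ (fun i _ => eqt i)).
  by rewrite sumr_const card_ord mulr_natl.
(* With q_i = r_i - c:
   sum_i (|q_i| - t)^2 = sum_i q_i^2 - 2 t E + n t^2 <= 2 t (n t - E). *)
have ge_const : n%:R * t <= E -> forall i, `|r 0 i - c| = t.
  move=> le_E.
  have sq0 : \sum_i (`|r 0 i - c| - t) ^+ 2 <= 0.
    have -> : \sum_i (`|r 0 i - c| - t) ^+ 2 =
        \sum_i (r 0 i - c) ^+ 2 - 2 * t * E + n%:R * t ^+ 2.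
      have -> : n%:R * t ^+ 2 = \sum_(i < n) t ^+ 2.
        by rewrite sumr_const card_ord mulr_natl.
      rewrite /E mulr_sumr -sumrB -big_split /=; apply: eq_bigr => i _.
      by rewrite sqrrB real_normK ?num_real //; ring.
    have := ler_wpM2l t_ge0 le_E; move: le_t; set S := \sum_i _; nra.
  have sq_ge0 i : true -> 0 <= (`|r 0 i - c| - t) ^+ 2 by rewrite sqr_ge0.
  have /eqP : \sum_i (`|r 0 i - c| - t) ^+ 2 = 0.
    by apply/eqP; rewrite eq_le sq0 sumr_ge0.
  rewrite psumr_eq0 // => /allP eq0 i; apply/eqP; rewrite -subr_eq0 -sqrf_eq0.
  by have := eq0 i; rewrite mem_index_enum; apply.
split.
  (* A sum above [n t] would force every [|r 0 i - c|] to be [t], and hence the sum to be exactly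
     [n t]. *)
  rewrite leNgt; apply/negP => lt_E.
  by move: (lt_E); rewrite (const_t (ge_const (ltW lt_E))) ltxx.
split=> [eqE i|eqs].
  by rewrite -real_normK ?num_real // ge_const // eqE.
apply: const_t => i; apply/eqP; rewrite -(eqrXn2 (n := 2)) //.
by rewrite real_normK ?num_real // eqs.
Qed.

(** * Degrees *)

(** Double counting of incidences: a degree counts the edges through a vertex, and every edge has
    two distinct ends. *)
Lemma sum_degree (G : sgraph) : (\sum_(x : G) degree x = 2 * #|edges G|)%N.
Proof.
have degE x : degree x = (\sum_(e in edges G) (x \in e))%N.
  rewrite -big_mkcondr /= sum1dep_card /degree.
  rewrite -(card_in_imset (f := fun y : G => [set x; y])); last first.
    move=> y z; rewrite !inE => xy _ /setP/(_ y); rewrite !inE eqxx orbT.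
    case: (eqVneq y x) => [yx|_ /esym/eqP //].
    by rewrite yx adj_irrefl in xy.
  apply: eq_card => e; rewrite [RHS]inE; apply/imsetP/andP.
    move=> [y]; rewrite inE => xy ->; split; last by rewrite !inE eqxx.
    by apply/imset2P; exists x y; rewrite // inE xy.
  move=> [/imset2P[a b _]]; rewrite inE /= => ab ->; rewrite !inE.
  case/orP => /eqP ->; first by exists b; rewrite ?inE.
  by exists a; rewrite 1?setUC // inE adj_sym.
rewrite (eq_bigr _ (fun x _ => degE x)) exchange_big /= mulnC -sum_nat_const.
apply: eq_bigr => e /imset2P[a b _]; rewrite inE /= => ab ->.
rewrite -big_mkcond sum1_card cards2.
by case: eqP ab => // ->; rewrite adj_irrefl.
Qed.

Lemma le_maxdeg (G : sgraph) (x : G) : (degree x <= maxdeg G)%N.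
Proof. exact: leq_bigmax. Qed.

Lemma mindeg_le (G : sgraph) (x : G) : (mindeg G <= degree x)%N.
Proof.
rewrite /mindeg; elim: index_enum (mem_index_enum x) => // y s IHs.
rewrite inE big_cons => /predU1P[->|/IHs le_x]; first exact: geq_minl.
exact: leq_trans (geq_minr _ _) le_x.
Qed.

Lemma regular_maxdeg_mindeg (G : sgraph) k : (0 < #|G|)%N ->
  (forall x : G, degree x = k) -> maxdeg G = k /\ mindeg G = k.
Proof.
move=> /card_gt0P[x0 _] reg; split.
  apply/eqP; rewrite eqn_leq -[in X in _ && X](reg x0) le_maxdeg andbT.
  by apply/bigmax_leqP => x _; rewrite reg.
apply/eqP; rewrite eqn_leq -[in X in X && _](reg x0) mindeg_le /=.
rewrite /mindeg; elim/big_ind: _ => [|a b ka kb|x _].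
(* The initial value [#|G|] of the minimum is harmless, since the degree [k] is at most [#|G|]. *)
- by rewrite -(reg x0) max_card.
- by rewrite leq_min ka.
- by rewrite reg.
Qed.

(* Popoviciu's inequality: the sum of squared deviations is least around the
   mean, hence at most the one around (a + b) / 2. *)
Lemma sum_sqr_deviation_le (R : realFieldType) (I : finType) (f : I -> R)
    (a b mu : R) :
  (forall i, a <= f i <= b) -> \sum_i f i = #|I|%:R * mu ->
  \sum_i (f i - mu) ^+ 2 <= #|I|%:R * ((b - a) ^+ 2 / 4).
Proof.
move=> fab fmu; pose c := (a + b) / 2.
have -> : \sum_i (f i - mu) ^+ 2 =
    \sum_i (f i - c) ^+ 2 - #|I|%:R * (mu - c) ^+ 2.
  have expand e : \sum_i (f i - e) ^+ 2 =
      \sum_i f i ^+ 2 - 2 * e * (\sum_i f i) + #|I|%:R * e ^+ 2.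
    rewrite mulr_sumr -sumrB [#|I|%:R * _]mulr_natl -sumr_const -big_split /=.
    by apply: eq_bigr => i _; ring.
  by rewrite !expand fmu; ring.
rewrite lerBlDr; apply: (@le_trans _ _ (#|I|%:R * ((b - a) ^+ 2 / 4))).
  rewrite mulr_natl -sumr_const; apply: ler_sum => i _.
  by have /andP[] := fab i; rewrite /c; nra.
by rewrite lerDl mulr_ge0 // sqr_ge0.
Qed.

(** * The square of the shifted matrix *)

(** Its cardinality counts the walks of length two from [x] to [y], an entry of the squared
    adjacency matrix. *)
Definition common_neighbors (G : sgraph) (x y : G) : {set G} :=
  [set z | adj x z && adj z y].

Section SquaredDeviation.

Variables (R : rcfType) (G : sgraph) (alpha mu : R).

Let dev (x : G) : R := (degree x)%:R - mu.
Let B : 'M[R]_#|G| := Aalpha alpha G - (alpha * mu)%:M.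

Lemma Aalpha_sym : (Aalpha alpha G)^T = Aalpha alpha G.
Proof.
rewrite /Aalpha linearD !linearZ /= tr_diag_mx; congr (_ + _ *: _).
by apply/matrixP => i j; rewrite !mxE adj_sym.
Qed.

(** [B] is [alpha] times the diagonal matrix of the [dev x] plus [1 - alpha] times the adjacency
    matrix; the summands are the diagonal square, the two mixed products and the walks of length
    two. *)
Lemma sqr_Aalpha_deviationE (i j : 'I_#|G|) :
  let x : G := enum_val i in let y : G := enum_val j in
  (B *m B) i j = (alpha * dev x) ^+ 2 *+ (i == j) +
    alpha * (1 - alpha) * (dev x + dev y) * (adj x y)%:R +
    (1 - alpha) ^+ 2 * #|common_neighbors x y|%:R.
Proof.
move=> x y; pose D : 'M[R]_#|G| := diag_mx (\row_i (alpha * dev (enum_val i))).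
have -> : B = D + (1 - alpha) *: adjmx R G.
  apply/matrixP => k l; rewrite !mxE /dev.
  by case: eqP => _; rewrite ?mulr1n ?mulr0n; ring.
rewrite !(mulmxDl, mulmxDr) !mul_diag_mx mul_mx_diag -scalemxAl -scalemxAr.
rewrite !mxE -/x -/y.
have -> : #|common_neighbors x y|%:R =
    \sum_k adjmx R G i k * adjmx R G k j :> R.
  rewrite -sum1dep_card big_mkcond natr_sum /=.
  rewrite (reindex (fun k : 'I_#|G| => enum_val k)) /=; last first.
    exact/onW_bij/enum_val_bij.
  by apply: eq_bigr => k _; rewrite !mxE -natrM mulnb; case: ifP.
by case: (eqVneq i j) => [->|_]; rewrite ?mulr1n ?mulr0n; ring.
Qed.

(** On the diagonal the mixed term vanishes, as there are no loops, and the walk term is a degree;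
    degrees sum to [2 m]. *)
Lemma mxtrace_sqr_Aalpha_deviation :
  \tr (B *m B) = alpha ^+ 2 * (\sum_x dev x ^+ 2) +
    (1 - alpha) ^+ 2 * (2 * #|edges G|%:R).
Proof.
rewrite -natrM -sum_degree natr_sum !mulr_sumr -big_split /=.
rewrite (reindex (fun k : 'I_#|G| => enum_val k)) /=; last first.
  exact/onW_bij/enum_val_bij.
apply: eq_bigr => i _; rewrite sqr_Aalpha_deviationE eqxx adj_irrefl.
have -> : common_neighbors (enum_val i) (enum_val i) =
    [set y | adj (enum_val i) y].
  by apply/setP => y; rewrite !inE [adj y _]adj_sym andbb.
by rewrite mulr1n mulr0 addr0 exprMn.
Qed.

End SquaredDeviation.

(** * Complete graphs *)

(** Induction on a path from [x] to [y]: its second vertex is [y] or, by induction, adjacent to [y],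
    and then [tr] shortcuts it. *)
Lemma connected_trans_complete (G : sgraph) : connected G ->
  (forall x y z : G, x != y -> adj x z -> adj z y -> adj x y) ->
  forall x y : G, adj x y = (x != y).
Proof.
move=> [_ conn] tr x y; apply/idP/idP => [|xy].
  by apply: contraTneq => ->; rewrite adj_irrefl.
have /connectP[p] := conn x y.
elim: p x xy => [|z p IHp] x xy /= => [_ eqy|/andP[xz pz] eqy].
  by rewrite eqy eqxx in xy.
case: (eqVneq z y) => [<- //|zy].
exact: tr xy xz (IHp z zy pz eqy).
Qed.

Lemma complete_degree (G : sgraph) (x : G) :
  (forall x y : G, adj x y = (x != y)) -> degree x = #|G|.-1.
Proof.
move=> complete; rewrite /degree -(cardsC1 x); apply: eq_card => y.
by rewrite !inE complete eq_sym.
Qed.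

Lemma isomorphic_K2 (G : sgraph) :
  isomorphic G (complete_graph 2) <->
  #|G| = 2 /\ forall x y : G, adj x y = (x != y).
Proof.
split=> [[f fbij adjf]|[G2 complete]].
  split; first by rewrite (bij_eq_card fbij) card_ord.
  by move=> x y; rewrite -adjf /= (bij_eq fbij).
exists (fun x : G => cast_ord G2 (enum_rank x) : complete_graph 2).
  apply: bij_comp; last exact: enum_rank_bij.
  by exists (cast_ord (esym G2)); [apply: cast_ordK | apply: cast_ordKV].
move=> x y; rewrite complete /= (inj_eq (@cast_ord_inj _ _ G2)).
by rewrite (inj_eq enum_rank_inj).
Qed.

(** * The energy bound and its equality case *)

(** On a single vertex both sides are 0, so the equality case is stated for at least two
    vertices. *)
Theorem corollary4p9 (R : rcfType) (alpha : R) (G : sgraph)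
    (alpha_ge0 : 0 <= alpha) (alpha_lt1 : alpha < 1) (Gconn : connected G) :
  let n : R := #|G|%:R in
  let m : R := #|edges G|%:R in
  let Delta : R := (maxdeg G)%:R in
  let delta : R := (mindeg G)%:R in
  let bound : R :=
    n * Num.sqrt (2 * m * (1 - alpha) ^+ 2 / n
                  + alpha ^+ 2 / 4 * (Delta - delta) ^+ 2) in
  Aalpha_energy alpha G <= bound /\
  ((1 < #|G|)%N ->
   (Aalpha_energy alpha G = bound <-> isomorphic G (complete_graph 2))).
Proof.
move=> n m Delta delta; set T := _ + _; move=> bound.
have G_gt0 : (0 < #|G|)%N by case: Gconn.
have n_gt0 : 0 < n by rewrite ltr0n.
have n_neq0 : n != 0 by rewrite gt_eqF.
(* The average degree; [alpha * mu] is the shift in the energy. *)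
pose mu := 2 * m / n.
have meanE : 2 * alpha * m / n = alpha * mu by rewrite /mu; field.
have nmu : n * mu = 2 * m by rewrite /mu; field.
have T_ge0 : 0 <= T.
  apply: addr_ge0.
    by rewrite divr_ge0 ?ler0n // mulr_ge0 ?sqr_ge0 // mulr_ge0 ?ler0n.
  by rewrite mulr_ge0 ?sqr_ge0 // divr_ge0 ?sqr_ge0 ?ler0n.
have degree_sum : \sum_(x : G) (degree x)%:R = n * mu :> R.
  by rewrite nmu -natr_sum sum_degree natrM.
have trace_le : \tr ((Aalpha alpha G - (alpha * mu)%:M) *m
                     (Aalpha alpha G - (alpha * mu)%:M)) <=
                n * Num.sqrt T ^+ 2.
  have dev_le : \sum_(x : G) ((degree x)%:R - mu) ^+ 2 <=
      n * ((Delta - delta) ^+ 2 / 4).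
    apply: sum_sqr_deviation_le => // x.
    by rewrite !ler_nat mindeg_le le_maxdeg.
  rewrite mxtrace_sqr_Aalpha_deviation sqr_sqrtr //.
  have -> : n * T = alpha ^+ 2 * (n * ((Delta - delta) ^+ 2 / 4)) +
                    (1 - alpha) ^+ 2 * (2 * m) by rewrite /T; field.
  by rewrite lerD2r ler_wpM2l ?sqr_ge0.
have [] := sum_norm_deviation (Aalpha_sym G alpha) (sqrtr_ge0 T) trace_le.
rewrite /Aalpha_energy -/n -/m meanE sqr_sqrtr // => energy_le energy_eq.
split=> // G_gt1; rewrite energy_eq isomorphic_K2.
have deviationE (x y : G) :
    ((Aalpha alpha G - (alpha * mu)%:M) *m (Aalpha alpha G - (alpha * mu)%:M))
      (enum_rank x) (enum_rank y) =
    (alpha * ((degree x)%:R - mu)) ^+ 2 *+ (x == y) +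
    alpha * (1 - alpha) * ((degree x)%:R - mu + ((degree y)%:R - mu)) *
      (adj x y)%:R +
    (1 - alpha) ^+ 2 * #|common_neighbors x y|%:R.
  by rewrite sqr_Aalpha_deviationE !enum_rankK (inj_eq enum_rank_inj).
have complete_mean : (forall x y : G, adj x y = (x != y)) ->
    forall x : G, (degree x)%:R = mu.
  move=> complete x; apply: (mulfI n_neq0); rewrite -degree_sum.
  under [RHS]eq_bigr => y _ do rewrite (complete_degree y complete).
  by rewrite sumr_const mulr_natl complete_degree.
split=> [sqE|[G2 complete]].
  have offdiag0 (x y : G) : x != y ->
      alpha * (1 - alpha) * ((degree x)%:R - mu + ((degree y)%:R - mu)) *
        (adj x y)%:R +
      (1 - alpha) ^+ 2 * #|common_neighbors x y|%:R = 0.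
    move=> /negPf xy; have := deviationE x y.
    by rewrite sqE mxE (inj_eq enum_rank_inj) xy !mulr0n add0r => <-.
  have no_common (x y : G) :
      (1 - alpha) ^+ 2 * #|common_neighbors x y|%:R = 0 ->
      common_neighbors x y = set0.
    move/eqP; rewrite mulf_eq0 sqrf_eq0 subr_eq0 gt_eqF //= pnatr_eq0 cards_eq0.
    by move/eqP.
  (* For distinct non-adjacent vertices only the walk term is left in [offdiag0]; its factor is
     nonzero as [alpha < 1], so they have no common neighbour. *)
  have complete : forall x y : G, adj x y = (x != y).
    apply: connected_trans_complete => // x y z xy xz zy.
    apply/negPn/negP => /negPf nadj; have := offdiag0 x y xy.
    rewrite nadj mulr0 add0r => /no_common/setP/(_ z).
    by rewrite !inE xz zy.
  split=> //; apply/eqP; rewrite eqn_leq G_gt1 andbT.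
  have /card_gt1P[x [y [_ _ xy]]] := G_gt1.
  have := offdiag0 x y xy.
  (* All degrees now equal [mu], so the mixed term vanishes for adjacent vertices too; a third
     vertex would be a common neighbour of [x] and [y]. *)
  rewrite !complete_mean // subrr addr0 mulr0 mul0r add0r => /no_common none.
  rewrite -(_ : #|[set x; y]| = 2); last by rewrite cards2 xy.
  apply/subset_leq_card/subsetP => z _; rewrite !inE.
  have := in_set0 z; rewrite -none inE !complete [x == z]eq_sym.
  by case: eqP => //=; case: eqP.
have degree1 (x : G) : degree x = 1%N by rewrite complete_degree // G2.
have [maxdeg1 mindeg1] := regular_maxdeg_mindeg G_gt0 degree1.
have TE : T = (1 - alpha) ^+ 2.
  have n2 : n = 2 by rewrite /n G2.
  have m1 : 2 * m = 2.
    rewrite -nmu -degree_sum -natr_sum.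
    by under eq_bigr => x _ do rewrite degree1; rewrite sum1_card G2.
  rewrite /T m1 n2 /Delta /delta maxdeg1 mindeg1 subrr expr0n /= mulr0 addr0.
  by field.
apply/matrixP => i j; rewrite -(enum_valK i) -(enum_valK j) deviationE mxE.
move: (enum_val i) (enum_val j) => x y.
rewrite (inj_eq enum_rank_inj) !complete_mean // subrr addr0 !mulr0 expr0n mul0r.
rewrite mul0rn !add0r TE.
(* With two vertices this complement has one element if [x = y] and none otherwise, so the walk term
   is the scalar matrix of [T]. *)
have -> : common_neighbors x y = ~: [set x; y].
  by apply/setP => z; rewrite !inE !complete [x == z]eq_sym negb_or.
have /(canRL (addKn _)) -> := cardsC [set x; y]; rewrite cards2 G2.
by case: (x == y); rewrite ?mulr1 ?mulr0.
Qed.
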